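(* Let $G=H\rtimes\mathbb Z$ where $H$ is a group, $\mathbb Z=\langle t\rangle$ acts by $tht^{-1}=\alpha(h)$ for $h\in H$, and $\alpha\in\operatorname{Aut}(H)$. Let $S\subseteq H$ be a symmetric subset such that (i) $\alpha(S)\subseteq S$, and (ii) $\bigcup_{n\ge 0}\alpha^{-n}(S)$ generates $H$. For a positive integer $i$ define subsets $Q^i_0=S$ and $Q^i_{n+1}=Q^i_n\cup\alpha^i(Q^i_n\cdot Q^i_n)$ for $n\ge 0$, and let $Q^i=\bigcup_{n\ge 0}Q^i_n$. Then $Q^i$ is a confining subset of $H$ under the action of $\alpha$.
   Context: For subsets, $Q\cdot Q=\{xy\mid x,y\in Q\}$; a subset is symmetric if it is closed under inverses. A symmetric subset $Q\subseteq H$ is confining under the action of $\alpha\in\operatorname{Aut}(H)$ if (a) $\alpha(Q)\subseteq Q$; (b) $H=\bigcup_{k\ge 0}\alpha^{-k}(Q)$; and (c) $\alpha^{k_0}(Q\cdot Q)\subseteq Q$ for some $k_0\in\mathbb Z_{\ge 0}$.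
   Formalization: The set S is additionally assumed nonempty: if H is trivial and S is empty, all stated hypotheses hold, but every Q^i is empty, so the union of the α^{-k}(Q^i) is empty and not H; this is the only case excluded. *)

(* Defs.v *)
From HB Require Import structures.
From mathcomp Require Import all_boot all_order all_algebra.
From mathcomp Require Import boolp classical_sets.

Set Implicit Arguments.
Unset Strict Implicit.
Unset Printing Implicit Defensive.

Local Open Scope classical_set_scope.
Local Open Scope group_scope.

Section Subsets.
Variable H : groupType.
Implicit Types (Q S K : set H) (alpha : H -> H).

Definition setmul (A B : set H) : set H := [set x * y | x in A & y in B].

Definition symmetric_set Q : Prop := forall x, Q x -> Q x^-1.

Definition subgroup K : Prop := K 1 /\ forall x y, K x -> K y -> K (x / y).

Definition generates (A : set H) : Prop := smallest subgroup A = setT.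

(* For a bijective alpha, the preimage of Q under alpha ^ k is the set
   alpha^{-k}(Q). *)
Definition confining alpha Q : Prop :=
  [/\ symmetric_set Q,
      alpha @` Q `<=` Q,
      \bigcup_k (iter k alpha @^-1` Q) = setT
    & exists k0, iter k0 alpha @` setmul Q Q `<=` Q].

Fixpoint Qseq alpha S (i n : nat) : set H :=
  if n is m.+1 then
    Qseq alpha S i m `|`
      iter i alpha @` setmul (Qseq alpha S i m) (Qseq alpha S i m)
  else S.

Definition Qlim alpha S (i : nat) : set H := \bigcup_n Qseq alpha S i n.

End Subsets.

Definition expgz (G : groupType) (x : G) (n : int) : G :=
  match n with Posz m => x ^+ m | Negz m => x ^- m.+1 end.

(* G, with the copy iota(H) of H and the element t, is the (internal)
   semidirect product of H and the infinite cyclic group <t>, where t acts on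
   H as alpha. A multiplicative map between groups preserves 1 and inverses. Unique factorisation g = iota(h) t^n forces iota to be injective
   and t to have infinite order. *)
Definition is_semidirect_Z (H G : groupType) (alpha : H -> H)
    (iota : {multiplicative H -> G}) (t : G) : Prop :=
  (forall h : H, t * iota h * t^-1 = iota (alpha h)) /\
  bijective (fun p : H * int => iota p.1 * expgz t p.2).

(* Such a G exists for every automorphism alpha. *)
Section Existence.
Variables (H : groupType) (alpha : {multiplicative H -> H}) (beta : H -> H).
Hypotheses (ab : cancel alpha beta) (ba : cancel beta alpha).

Let az (n : int) : H -> H :=
  match n with Posz m => iter m alpha | Negz m => iter m.+1 beta end.

Let azS n x : az (n + 1)%R x = alpha (az n x).
Proof.
case: n => [n|[|n]]; first by rewrite -PoszD addn1.
  by rewrite /= ba.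
have -> : (Negz n.+1 + 1)%R = Negz n.
  by rewrite !NegzE -[n.+2]addn1 PoszD GRing.opprD GRing.subrK.
by rewrite /= ba.
Qed.

Let azP n x : az (n - 1)%R x = beta (az n x).
Proof. by apply: (can_inj ab); rewrite -azS GRing.subrK ba. Qed.

Let azD m n x : az (m + n)%R x = az m (az n x).
Proof.
elim: m => [|m IH|m IH]; first by rewrite GRing.add0r.
  by rewrite -addn1 PoszD GRing.addrAC !azS IH.
by rewrite -addn1 PoszD GRing.opprD GRing.addrAC !azP IH.
Qed.

Let azM n x y : az n (x * y) = az n x * az n y.
Proof.
have bM u v : beta (u * v) = beta u * beta v.
  by apply: (can_inj ab); rewrite gmulfM !ba.
case: n => n; rewrite /az.
  by elim: n => //= n ->; rewrite gmulfM.
by elim: n.+1 => //= k ->; rewrite bM.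
Qed.

Let az1 n : az n 1 = 1.
Proof. by apply: (mulgI (az n 1)); rewrite -azM !mulg1. Qed.

Definition sdZ : Type := (H * int)%type.
HB.instance Definition _ := Choice.on sdZ.

Let mul (x y : sdZ) : sdZ := (x.1 * az x.2 y.1, (x.2 + y.2)%R).
Let inv (x : sdZ) : sdZ := (az (- x.2)%R x.1^-1, (- x.2)%R).

Let mulA : associative mul.
Proof.
by move=> x y z; rewrite /mul /= azM -azD mulgA GRing.addrA.
Qed.

Let mul1 : left_id ((1, 0%R) : sdZ) mul.
Proof. by case=> h n; rewrite /mul /= mul1g GRing.add0r. Qed.

Let mulr1 : right_id ((1, 0%R) : sdZ) mul.
Proof. by case=> h n; rewrite /mul /= az1 mulg1 GRing.addr0. Qed.

Let mulV : left_inverse ((1, 0%R) : sdZ) inv mul.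
Proof.
by case=> h n; rewrite /mul /inv /= -azM mulVg az1 GRing.addNr.
Qed.

Let mulrV : right_inverse ((1, 0%R) : sdZ) inv mul.
Proof.
by case=> h n; rewrite /mul /inv /= -azD GRing.subrr mulgV.
Qed.

HB.instance Definition _ :=
  isGroup.Build sdZ mulA mul1 mulr1 mulV mulrV.

Definition sdZ_inj (h : H) : sdZ := (h, 0%R).

Let sdZ_injM : {morph sdZ_inj : x y / x * y}.
Proof. by []. Qed.

HB.instance Definition _ := isMultiplicative.Build H sdZ sdZ_inj sdZ_injM.

Lemma sdZ_semidirect : is_semidirect_Z alpha sdZ_inj ((1, 1%R) : sdZ).
Proof.
have mulE (x y : sdZ) : x * y = mul x y by [].
have invE (x : sdZ) : x^-1 = inv x by [].
have tN m : ((1, 1%R) : sdZ) ^+ m = (1, Posz m).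
  elim: m => // m IH; rewrite expgS IH mulE /mul [fst _]/= [fst _]/=.
  by rewrite az1 mulg1.
have tE n : expgz ((1, 1%R) : sdZ) n = (1, n).
  case: n => n; rewrite /expgz tN // invE /inv [fst _]/= invg1 az1.
  by rewrite NegzE.
split=> [h|].
  rewrite invE !mulE /mul /inv [fst _]/= [fst _]/= [fst _]/= invg1 !az1.
  by rewrite /sdZ_inj /= mul1g mulg1.
exists id => -[h n]; rewrite tE mulE /mul /= mulg1 GRing.add0r //.
Qed.

End Existence.

Lemma semidirect_Z_exists (H : groupType) (alpha : {multiplicative H -> H}) :
  bijective alpha ->
  exists (G : groupType) (iota : {multiplicative H -> G}) (t : G),
    is_semidirect_Z alpha iota t.
Proof. by case=> b ab ba; do 3!eexists; exact: sdZ_semidirect ab ba. Qed.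

(* Main.v *)
Require Import Defs.
From mathcomp Require Import all_boot all_order all_algebra.
From mathcomp Require Import boolp classical_sets.

(** Each stage [Qseq alpha S i n] is symmetric and stable under [alpha], and the
    stages increase with [n]; hence so is their union Q. The recursion is
    designed to give [alpha^i(Q Q) <= Q]: two elements of Q lie in a common
    stage, and the next stage contains the [alpha^i]-image of their product.

    It remains to see that the sets [alpha^{-k}(Q)] exhaust H. For any
    nonempty symmetric stable Q with [alpha^k0(Q Q) <= Q], their union K is a
    subgroup ([subgroup_bigcup_preimage_iter]): stability makes the union
    increasing, so two elements of K are both sent into Q by a single power
    [alpha^m], and then [alpha^(k0 + m)] sends their quotient into Q. As
    [S <= Q], K contains the given generators of H, so K = H. *)

Local Open Scope classical_set_scope.
Local Open Scope group_scope.

Section IteratedEndomorphism.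
Variables (H : groupType) (alpha : {multiplicative H -> H}).

Lemma iter_gmulfM n x y :
  iter n alpha (x * y) = iter n alpha x * iter n alpha y.
Proof. by elim: n => //= n ->; rewrite gmulfM. Qed.

(** A multiplicative map between groups fixes 1 because its image of 1 is
    idempotent; preservation of inverses follows by cancellation. *)
Lemma iter_gmulfV n x : iter n alpha x^-1 = (iter n alpha x)^-1.
Proof.
have iter1 : iter n alpha 1 = 1.
  by apply: (mulgI (iter n alpha 1)); rewrite -iter_gmulfM !mulg1.
by apply: (mulgI (iter n alpha x)); rewrite -iter_gmulfM !mulgV iter1.
Qed.

Lemma iter_stable (Q : set H) n x :
  alpha @` Q `<=` Q -> Q x -> Q (iter n alpha x).
Proof.
by move=> Qst Qx; elim: n => //= n IH; apply: Qst; exists (iter n alpha x).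
Qed.

Lemma iter_stable_le (Q : set H) m n x : alpha @` Q `<=` Q ->
  (m <= n)%N -> Q (iter m alpha x) -> Q (iter n alpha x).
Proof. by move=> Qst mn Qx; rewrite -(subnK mn) iterD; apply: iter_stable. Qed.

(** The quotient of two elements sent into Q by [alpha^k] and [alpha^l] is sent
    into Q by [alpha^(k0 + max k l)]; nonemptiness puts 1 in the union, as
    the quotient of an element of Q by itself. *)
Lemma subgroup_bigcup_preimage_iter (Q : set H) k0 :
    Q !=set0 -> symmetric_set Q -> alpha @` Q `<=` Q ->
    iter k0 alpha @` setmul Q Q `<=` Q ->
  subgroup (\bigcup_k (iter k alpha @^-1` Q)).
Proof.
move=> [q Qq] Qsym Qst Qmul.
have Kdiv x y : (\bigcup_k (iter k alpha @^-1` Q)) x ->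
    (\bigcup_k (iter k alpha @^-1` Q)) y ->
    (\bigcup_k (iter k alpha @^-1` Q)) (x / y).
  move=> [k _ Qx] [l _ Qy]; exists (k0 + maxn k l)%N => //=.
  rewrite iterD iter_gmulfM iter_gmulfV; apply: Qmul.
  exists (iter (maxn k l) alpha x / iter (maxn k l) alpha y) => //.
  exists (iter (maxn k l) alpha x).
    exact: iter_stable_le Qst (leq_maxl k l) Qx.
  exists (iter (maxn k l) alpha y)^-1 => //; apply: Qsym.
  exact: iter_stable_le Qst (leq_maxr k l) Qy.
split=> //; rewrite -(mulgV q).
by apply: Kdiv; exists 0%N.
Qed.

Section Stages.
Variables (S : set H) (i : nat).
Local Notation Q := (Qseq alpha S i).

Lemma Qseq_le m n : (m <= n)%N -> Q m `<=` Q n.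
Proof.
by move=> mn; rewrite -(subnK mn); elim: (n - m)%N => // k IH x Qx; left; apply: IH.
Qed.

(** Inversion reverses products, but the set of products [Q n * Q n] is
    insensitive to the order of its factors. *)
Lemma symmetric_Qseq n : symmetric_set S -> symmetric_set (Q n).
Proof.
move=> Ssym; elim: n => //= n IH x [/IH|[_ [y Qy [z Qz <-]] <-]]; first by left.
right; exists (y * z)^-1; last exact: iter_gmulfV.
rewrite invgM; exists z^-1; first exact: IH.
by exists y^-1 => //; apply: IH.
Qed.

Lemma Qseq_stable n : alpha @` S `<=` S -> alpha @` Q n `<=` Q n.
Proof.
move=> Sst; elim: n => //= n IH _ [x [Qx|[_ [y Qy [z Qz <-]] <-]] <-].
  by left; apply: IH; exists x.
right; exists (alpha (y * z)); last by rewrite -iterSr.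
rewrite gmulfM; exists (alpha y); first by apply: IH; exists y.
by exists (alpha z) => //; apply: IH; exists z.
Qed.

Lemma Qlim_mul :
  iter i alpha @` setmul (Qlim alpha S i) (Qlim alpha S i) `<=` Qlim alpha S i.
Proof.
move=> _ [_ [x [m _ Qx] [y [n _ Qy] <-]] <-].
exists (maxn m n).+1 => //; right; exists (x * y) => //.
exists x; first exact: Qseq_le (leq_maxl m n) _ Qx.
by exists y => //; apply: Qseq_le (leq_maxr m n) _ Qy.
Qed.

End Stages.
End IteratedEndomorphism.

Theorem proposition5p1 (H G : groupType) (alpha : {multiplicative H -> H})
    (alpha_bij : bijective alpha)
    (iota : {multiplicative H -> G}) (t : G)
    (G_sd : is_semidirect_Z alpha iota t)
    (S : set H) (S_neq0 : S !=set0) (S_sym : symmetric_set S)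
    (S_stable : alpha @` S `<=` S)
    (S_gen : generates (\bigcup_n (iter n alpha @^-1` S)))
    (i : nat) (i_gt0 : (0 < i)%N) :
  confining alpha (Qlim alpha S i).
Proof.
have SQ : S `<=` Qlim alpha S i by move=> x Sx; exists 0%N.
have Qsym : symmetric_set (Qlim alpha S i).
  by move=> x [n _ Qx]; exists n => //; apply: symmetric_Qseq.
have Qst : alpha @` Qlim alpha S i `<=` Qlim alpha S i.
  move=> _ [x [n _ Qx] <-]; exists n => //.
  by apply: Qseq_stable => //; exists x.
have Qmul := @Qlim_mul H alpha S i.
split=> //; last by exists i.
apply/seteqP; split=> // x _.
have : smallest (@subgroup H) (\bigcup_n (iter n alpha @^-1` S)) x.
  by rewrite S_gen.
apply; split; last by move=> y [n _ Sy]; exists n => //; apply: SQ.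
apply: subgroup_bigcup_preimage_iter Qmul => //.
by case: S_neq0 => s /SQ; exists s.
Qed.
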